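(* For every $\Gamma\cup\{\phi\}\subseteq\mathcal{L}_{\Box\Diamond}$: $\Gamma\Vdash^{\mathrm{inm}}\phi$ if and only if $\Gamma\models\phi$.
   Context: $\mathcal{L}_{\Box\Diamond}$: formulas $\phi ::= p_i \mid \bot \mid \phi\wedge\phi \mid \phi\vee\phi \mid \phi\to\phi \mid \Box\phi \mid \Diamond\phi$ over a countable set of proposition letters $p_i$. Intuitionistic neighbourhood models: for a poset $(W,\le)$, an intuitionistic neighbourhood is a partial function $a:W\rightharpoonup\mathcal{P}(W)$ whose domain $\mathrm{dom}(a)$ is an upset. A model is $\mathcal{M}=(W,\le,N,V)$ with $N$ a set of intuitionistic neighbourhoods and $V$ mapping proposition letters to upsets; $N_w=\{a\in N\mid w\in\mathrm{dom}(a)\}$. Truth: $w\Vdash p$ iff $w\in V(p)$; $\bot$ never; $\wedge,\vee$ pointwise; $w\Vdash\phi\to\psi$ iff for all $v\ge w$, $v\Vdash\phi$ implies $v\Vdash\psi$; $w\Vdash\Box\phi$ iff there is $a\in N_w$ such that for all $w'\ge w$ and all $v\in a(w')$, $v\Vdash\phi$; $w\Vdash\Diamond\phi$ iff for all $w'\ge w$ and all $a\in N_{w'}$ there is $v\in a(w')$ with $v\Vdash\phi$. $\Gamma\Vdash^{\mathrm{inm}}\phi$: in every such model, every world satisfying all of $\Gamma$ satisfies $\phi$. $\mathsf{IFOM}$-structures: $\mathfrak{M}=(W,\le,\mathcal{I})$ with $(W,\le)$ a poset and, for each $w$, sets $\mathcal{I}(\mathsf{s},w),\mathcal{I}(\mathsf{n},w)$,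 relations $\mathcal{I}(\mathsf{N},w)\subseteq\mathcal{I}(\mathsf{s},w)\times\mathcal{I}(\mathsf{n},w)$, $\mathcal{I}(\mathsf{E},w)\subseteq\mathcal{I}(\mathsf{n},w)\times\mathcal{I}(\mathsf{s},w)$, $\mathcal{I}(P_i,w)\subseteq\mathcal{I}(\mathsf{s},w)$, all increasing along $\le$. Evaluation at $(w,x)$ with $x\in\mathcal{I}(\mathsf{s},w)$: $w,x\models p_i$ iff $x\in\mathcal{I}(P_i,w)$; $\bot$ never; $\wedge,\vee$ pointwise; $w,x\models\phi\to\psi$ iff for all $w'\ge w$, $w',x\models\phi$ implies $w',x\models\psi$; $w,x\models\Box\phi$ iff there is $a\in\mathcal{I}(\mathsf{n},w)$ with $(x,a)\in\mathcal{I}(\mathsf{N},w)$ such that for all $w'\ge w$, $x'\in\mathcal{I}(\mathsf{s},w')$ with $(a,x')\in\mathcal{I}(\mathsf{E},w')$, $w',x'\models\phi$; $w,x\models\Diamond\phi$ iff for all $w'\ge w$ and $a'\in\mathcal{I}(\mathsf{n},w')$ with $(x,a')\in\mathcal{I}(\mathsf{N},w')$ there is $y'\in\mathcal{I}(\mathsf{s},w')$ with $(a',y')\in\mathcal{I}(\mathsf{E},w')$ and $w',y'\models\phi$. $\Gamma\models\phi$: for all $\mathsf{IFOM}$-structures and pairs $(w,x)$, satisfying all of $\Gamma$ implies satisfying $\phi$. *)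

(* Defs.v *)
From Stdlib Require Import Relations Ensembles.

Set Implicit Arguments.

Inductive form : Type :=
  | Var (i : nat)
  | Bot
  | And (phi psi : form)
  | Or (phi psi : form)
  | Imp (phi psi : form)
  | Box (phi : form)
  | Dia (phi : form).

Definition upset (W : Type) (le : relation W) (S : Ensemble W) : Prop :=
  forall w v, le w v -> S w -> S v.

(** [pfun W] is the type of partial functions from [W] to the powerset of [W];
    [None] means undefined, as opposed to the value [Some (Empty_set W)]. *)
Definition pfun (W : Type) : Type := W -> option (Ensemble W).

Definition dom (W : Type) (a : pfun W) : Ensemble W :=
  fun w => exists S, a w = Some S.

(** [v] belongs to [a(w)], where [a(w)] is defined. *)
Definition val (W : Type) (a : pfun W) (w v : W) : Prop :=
  exists S, a w = Some S /\ S v.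

Record inm_model : Type := {
  world : Type;
  wle : relation world;
  wle_order : order world wle;
  nbhd : Ensemble (pfun world);
  nbhd_dom_upset : forall a, nbhd a -> upset wle (dom a);
  valuation : nat -> Ensemble world;
  valuation_upset : forall i, upset wle (valuation i)
}.

Definition nbhd_at (M : inm_model) (w : world M) : Ensemble (pfun (world M)) :=
  fun a => nbhd M a /\ dom a w.

Fixpoint forces (M : inm_model) (w : world M) (phi : form) : Prop :=
  match phi with
  | Var i => valuation M i w
  | Bot => False
  | And phi psi => forces M w phi /\ forces M w psi
  | Or phi psi => forces M w phi \/ forces M w psi
  | Imp phi psi =>
      forall v, wle M w v -> forces M v phi -> forces M v psi
  | Box phi =>
      exists a, nbhd_at M w a /\
        forall w', wle M w w' -> forall v, val a w' v -> forces M v phi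
  | Dia phi =>
      forall w', wle M w w' -> forall a, nbhd_at M w' a ->
        exists v, val a w' v /\ forces M v phi
  end.

Definition inm_consequence (Gamma : Ensemble form) (phi : form) : Prop :=
  forall (M : inm_model) (w : world M),
    (forall psi, Gamma psi -> forces M w psi) -> forces M w phi.

(** The increasing domains of each of the two sorts are given as subsets of an
    ambient type ([sobj] for the state sort, [nobj] for the neighbourhood
    sort), so that elements of domains at different worlds can be compared. *)
Record ifom_structure : Type := {
  point : Type;
  ple : relation point;
  ple_order : order point ple;
  sobj : Type;
  nobj : Type;
  I_s : point -> Ensemble sobj;
  I_n : point -> Ensemble nobj;
  I_N : point -> sobj -> nobj -> Prop;
  I_E : point -> nobj -> sobj -> Prop;
  I_P : nat -> point -> Ensemble sobj;
  I_N_dom : forall w x a, I_N w x a -> I_s w x /\ I_n w a;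
  I_E_dom : forall w a x, I_E w a x -> I_n w a /\ I_s w x;
  I_P_dom : forall i w x, I_P i w x -> I_s w x;
  I_s_mono : forall w w', ple w w' -> forall x, I_s w x -> I_s w' x;
  I_n_mono : forall w w', ple w w' -> forall a, I_n w a -> I_n w' a;
  I_N_mono : forall w w', ple w w' -> forall x a, I_N w x a -> I_N w' x a;
  I_E_mono : forall w w', ple w w' -> forall a x, I_E w a x -> I_E w' a x;
  I_P_mono : forall i w w', ple w w' -> forall x, I_P i w x -> I_P i w' x
}.

(** Only meaningful when [x] lies in [I_s M w]; [ifom_consequence] imposes
    this, and the clauses below preserve it. *)
Fixpoint satisfies (M : ifom_structure) (w : point M) (x : sobj M)
    (phi : form) : Prop :=
  match phi with
  | Var i => I_P M i w x
  | Bot => False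
  | And phi psi => satisfies M w x phi /\ satisfies M w x psi
  | Or phi psi => satisfies M w x phi \/ satisfies M w x psi
  | Imp phi psi =>
      forall w', ple M w w' -> satisfies M w' x phi -> satisfies M w' x psi
  | Box phi =>
      exists a, I_n M w a /\ I_N M w x a /\
        forall w', ple M w w' -> forall x', I_s M w' x' -> I_E M w' a x' ->
          satisfies M w' x' phi
  | Dia phi =>
      forall w', ple M w w' -> forall a', I_n M w' a' -> I_N M w' x a' ->
        exists y', I_s M w' y' /\ I_E M w' a' y' /\ satisfies M w' y' phi
  end.

Definition ifom_consequence (Gamma : Ensemble form) (phi : form) : Prop :=
  forall (M : ifom_structure) (w : point M) (x : sobj M),
    I_s M w x ->
    (forall psi, Gamma psi -> satisfies M w x psi) -> satisfies M w x phi.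

(* Main.v *)
Require Import Defs.
From Stdlib Require Import Ensembles.
From Stdlib Require Import Relations List ClassicalEpsilon Lia.

(** An IFOM-structure yields a neighbourhood model on pairs [(w, x)], where
    only the first component grows along the order, and each neighbourhood
    object [a] becomes the partial function sending [(w, x)] with [N(x, a)] at
    [w] to the pairs [(w, y)] with [E(a, y)] at [w].

    Conversely, let [M] be a neighbourhood model. The points of the structure
    are histories, i.e. finite lists of worlds ordered by extension. A state
    [(h, v)] is born at history [h] in the world [v]; each time the history is
    extended by [u] it moves to [u] if [u] lies above its position, and stays
    otherwise. So every state can be sent to any world above its position. A
    neighbourhood object [(x, a, h)] is a copy of [a], attached to the state [x]
    at history [h]; at each later history [h'] it acquires new members, newly
    born in the worlds of [a(w')], where [w'] is the position of [x] at [h'].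
    Members are never lost, so an old copy may have members unrelated to the
    current value of [a], but a copy created at [h] has at [h] exactly the
    members prescribed by [a]. Hence truth of a formula at [(h, x)] is truth at
    the position of [x]. *)

(** Persistence is needed for members of a copy, which may move up after birth. For [Box] the same
    neighbourhood serves again, since its domain is an upset. *)
Lemma forces_mono (M : inm_model) (phi : form) (w v : world M) :
  wle M w v -> forces M w phi -> forces M v phi.
Proof.
  destruct (wle_order M) as [_ Htrans _].
  revert w v; induction phi as [i| |p IHp q IHq|p IHp q IHq|p IHp q IHq|p IHp|p IHp];
    simpl; intros w v Hwv H.
  - exact (valuation_upset M i _ _ Hwv H).
  - exact H.
  - destruct H; eauto.
  - destruct H; eauto.
  - intros u Hu; apply H; eauto.
  - destruct H as [a [[Ha Hd] H]]; exists a; repeat split; eauto.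
    exact (nbhd_dom_upset M Ha _ Hwv Hd).
  - intros u Hu; apply H; eauto.
Qed.

(** * From IFOM-structures to neighbourhood models *)

Section PairModel.
Variable M : ifom_structure.

Definition pair_le (p q : point M * sobj M) : Prop :=
  ple M (fst p) (fst q) /\ snd p = snd q.

Lemma pair_le_order : order _ pair_le.
Proof.
  destruct (ple_order M) as [Hrefl Htrans Hanti].
  unfold pair_le; split.
  - intros p; auto.
  - intros p q r [H1 H2] [H3 H4]; split; [eauto | congruence].
  - intros [w x] [v y] [H1 H2] [H3 _]; simpl in *; f_equal; auto.
Qed.

(** The domain encodes [I_N]. An [a] without [I_E]-successors still gets a defined, empty value,
    which refutes [Dia]. *)
Definition pair_nbhd (a : nobj M) : pfun (point M * sobj M) :=
  fun p => if excluded_middle_informative (I_N M (fst p) (snd p) a)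
           then Some (fun q => fst q = fst p /\ I_E M (fst p) a (snd q))
           else None.

Lemma dom_pair_nbhd a w x : dom (pair_nbhd a) (w, x) <-> I_N M w x a.
Proof.
  unfold dom, pair_nbhd; simpl.
  destruct (excluded_middle_informative _) as [H|H]; split; eauto.
  - intros [S HS]; discriminate.
  - contradiction.
Qed.

Lemma val_pair_nbhd a w x v y :
  val (pair_nbhd a) (w, x) (v, y) <-> I_N M w x a /\ v = w /\ I_E M w a y.
Proof.
  unfold val, pair_nbhd; simpl.
  destruct (excluded_middle_informative _) as [H|H]; split.
  - intros [S [HS Hy]]; injection HS as <-; auto.
  - intros [_ Hy]; eauto.
  - intros [S [HS _]]; discriminate.
  - intros [H' _]; contradiction.
Qed.

Definition pair_nbhds : Ensemble (pfun (point M * sobj M)) :=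
  fun f => exists a, f = pair_nbhd a.

Lemma pair_nbhds_dom_upset f : pair_nbhds f -> upset pair_le (dom f).
Proof.
  intros [a ->] [w x] [v y] [Hwv Hxy] H; simpl in *; subst y.
  apply dom_pair_nbhd in H; apply dom_pair_nbhd; exact (I_N_mono M _ _ Hwv _ _ H).
Qed.

Lemma pair_valuation_upset i :
  upset pair_le (fun p => I_P M i (fst p) (snd p)).
Proof.
  intros [w x] [v y] [Hwv Hxy] H; simpl in *; subst y.
  exact (I_P_mono M i _ _ Hwv _ H).
Qed.

Definition pair_model : inm_model :=
  {| wle_order := pair_le_order;
     nbhd_dom_upset := pair_nbhds_dom_upset;
     valuation_upset := pair_valuation_upset |}.

Lemma forces_pair_model (phi : form) (w : point M) (x : sobj M) :
  forces pair_model (w, x) phi <-> satisfies M w x phi.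
Proof.
  revert w x; induction phi as [i| |p IHp q IHq|p IHp q IHq|p IHp q IHq|p IHp|p IHp];
    intros w x; simpl.
  - reflexivity.
  - reflexivity.
  - rewrite IHp, IHq; reflexivity.
  - rewrite IHp, IHq; reflexivity.
  - split.
    + intros H v Hv Hp; apply IHq, H; [split; auto | now apply IHp].
    + intros H [v y] [Hv Hy] Hp; simpl in *; subst y.
      apply IHq, H, IHp; auto.
  - split.
    + intros [f [[[a ->] Hd] H]]; apply dom_pair_nbhd in Hd.
      exists a; split; [now apply (I_N_dom M) in Hd | split; [exact Hd |]].
      intros w' Hw y Hy HE; apply IHp.
      (* [a] is still defined at [(w', x)] because [I_N] grows, so its successors at [w'] are values
         there. *)
      apply (H (w', x)); [split; auto | apply val_pair_nbhd].
      split; [exact (I_N_mono M _ _ Hw _ _ Hd) | auto].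
    + intros [a [_ [HN H]]]; exists (pair_nbhd a); split.
      * split; [now exists a | now apply dom_pair_nbhd].
      * intros [w' x'] [Hw Hx] [v y] Hv; simpl in *.
        apply val_pair_nbhd in Hv as [_ [-> HE]].
        apply IHp, H; auto; now apply (I_E_dom M) in HE.
  - split.
    + intros H w' Hw a _ HN.
      destruct (H (w', x) (conj Hw eq_refl) (pair_nbhd a)) as [[v y] [Hv Hp]].
      * split; [now exists a | now apply dom_pair_nbhd].
      * apply val_pair_nbhd in Hv as [_ [-> HE]].
        exists y; split; [now apply (I_E_dom M) in HE | split; [exact HE |]].
        now apply IHp.
    + intros H [w' x'] [Hw Hx] f [[a ->] Hd]; simpl in *; subst x'.
      apply dom_pair_nbhd in Hd.
      destruct (H w' Hw a) as [y [_ [HE Hp]]];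
        [now apply (I_N_dom M) in Hd | exact Hd |].
      exists (w', y); split; [now apply val_pair_nbhd | now apply IHp].
Qed.

End PairModel.

(** * Finite histories under extension *)

Section Histories.
Variable W : Type.

(** The most recent entry of a history is its head. *)
Definition extends (h h' : list W) : Prop := exists l, h' = l ++ h.

Lemma extends_refl h : extends h h.
Proof. now exists nil. Qed.

Lemma extends_trans h1 h2 h3 : extends h1 h2 -> extends h2 h3 -> extends h1 h3.
Proof. intros [k ->] [l ->]; exists (l ++ k); apply app_assoc. Qed.

Lemma extends_cons h u : extends h (u :: h).
Proof. now exists (u :: nil). Qed.

Lemma extends_length h h' : extends h h' -> length h <= length h'.
Proof. intros [l ->]; rewrite length_app; lia. Qed.

Lemma extends_antisym h h' : extends h h' -> extends h' h -> h = h'.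
Proof.
  intros [[|u l] ->] H; [reflexivity |].
  apply extends_length in H; simpl in H; rewrite length_app in H; lia.
Qed.

Lemma extends_order : order _ extends.
Proof.
  split; [exact extends_refl | exact extends_trans | exact extends_antisym].
Qed.

End Histories.

Arguments extends {W} h h'.

(** * From neighbourhood models to IFOM-structures *)

Section HistoryStructure.
Variable M : inm_model.

Definition hist : Type := list (world M).
Definition state : Type := hist * world M.
Definition copy : Type := state * pfun (world M) * hist.

Definition move (w u : world M) : world M :=
  if excluded_middle_informative (wle M w u) then u else w.

(** Junk value [v] when [h] does not extend the birth [h0] of the state. *)
Fixpoint position (x : state) (h : hist) : world M :=
  match h with
  | nil => snd x
  | u :: t => if excluded_middle_informative (extends (fst x) t)
              then move (position x t) u else snd x
  end.

(** For nonempty [h] the default branch fires: the tail of [h] is too short to extend [h]. *)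
Lemma position_birth h v : position (h, v) h = v.
Proof.
  destruct h as [|u t]; simpl; [reflexivity |].
  destruct (excluded_middle_informative _) as [H|H]; [| reflexivity].
  apply extends_length in H; simpl in H; lia.
Qed.

Lemma position_move x h u :
  extends (fst x) h -> wle M (position x h) u -> position x (u :: h) = u.
Proof.
  intros Hx Hu; simpl.
  destruct (excluded_middle_informative _) as [_|H]; [| contradiction].
  unfold move; destruct (excluded_middle_informative _); [reflexivity | contradiction].
Qed.

Lemma position_mono x h h' :
  extends (fst x) h -> extends h h' -> wle M (position x h) (position x h').
Proof.
  destruct (wle_order M) as [Hrefl Htrans _].
  intros Hx [l ->]; induction l as [|u l IH]; simpl; [apply Hrefl |].
  destruct (excluded_middle_informative _) as [_|H].
  - unfold move; destruct (excluded_middle_informative _); eauto.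
  - elim H; eapply extends_trans; [exact Hx | now exists l].
Qed.

Definition live (h : hist) : Ensemble state := fun x => extends (fst x) h.

Definition copy_live (h : hist) : Ensemble copy :=
  fun n => let '(x, a, h0) := n in live h0 x /\ extends h0 h.

(** The neighbourhood is tested at the creation history [h0], so monotonicity in [h] is immediate;
    [nbhd_dom_upset] keeps it defined later. *)
Definition owns (h : hist) (x : state) (n : copy) : Prop :=
  copy_live h n /\
  let '(x', a, h0) := n in x' = x /\ nbhd_at M (position x h0) a.

(** The value of [a] is read at the birth [fst y], not at [h], so [y] remains a member even if it
    leaves that value as [x] moves. *)
Definition member (h : hist) (n : copy) (y : state) : Prop :=
  copy_live h n /\ live h y /\
  let '(x, a, h0) := n in
  extends h0 (fst y) /\ val a (position x (fst y)) (snd y).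

Definition hist_val (i : nat) (h : hist) : Ensemble state :=
  fun x => live h x /\ valuation M i (position x h).

Lemma live_mono h h' : extends h h' -> forall x, live h x -> live h' x.
Proof. intros H x Hx; exact (extends_trans _ _ _ _ Hx H). Qed.

Lemma copy_live_mono h h' :
  extends h h' -> forall n, copy_live h n -> copy_live h' n.
Proof.
  intros H [[x a] h0] [H1 H2]; split; [exact H1 |].
  exact (extends_trans _ _ _ _ H2 H).
Qed.

Lemma owns_dom h x n : owns h x n -> live h x /\ copy_live h n.
Proof.
  destruct n as [[x' a] h0]; intros [H [-> _]]; split; [| exact H].
  destruct H as [H1 H2]; exact (live_mono _ _ H2 _ H1).
Qed.

Lemma member_dom h n y : member h n y -> copy_live h n /\ live h y.
Proof. intros [H1 [H2 _]]; auto. Qed.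

Lemma hist_val_dom i h x : hist_val i h x -> live h x.
Proof. now intros [H _]. Qed.

Lemma owns_mono h h' :
  extends h h' -> forall x n, owns h x n -> owns h' x n.
Proof.
  intros H x n [H1 H2]; split; [exact (copy_live_mono _ _ H _ H1) | exact H2].
Qed.

Lemma member_mono h h' :
  extends h h' -> forall n y, member h n y -> member h' n y.
Proof.
  intros H n y [H1 [H2 H3]]; split; [exact (copy_live_mono _ _ H _ H1) |].
  split; [exact (live_mono _ _ H _ H2) | exact H3].
Qed.

Lemma hist_val_mono i h h' :
  extends h h' -> forall x, hist_val i h x -> hist_val i h' x.
Proof.
  intros H x [H1 H2]; split; [exact (live_mono _ _ H _ H1) |].
  exact (valuation_upset M i _ _ (position_mono _ _ _ H1 H) H2).
Qed.

Definition hist_structure : ifom_structure :=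
  {| ple_order := extends_order (world M);
     I_N_dom := owns_dom;
     I_E_dom := member_dom;
     I_P_dom := hist_val_dom;
     I_s_mono := live_mono;
     I_n_mono := copy_live_mono;
     I_N_mono := owns_mono;
     I_E_mono := member_mono;
     I_P_mono := hist_val_mono |}.

Lemma satisfies_hist_structure (phi : form) (h : hist) (x : state) :
  live h x ->
  (satisfies hist_structure h x phi <-> forces M (position x h) phi).
Proof.
  revert h x; induction phi as [i| |p IHp q IHq|p IHp q IHq|p IHp q IHq|p IHp|p IHp];
    intros h x Hx; simpl.
  - unfold hist_val; tauto.
  - reflexivity.
  - rewrite IHp, IHq by exact Hx; reflexivity.
  - rewrite IHp, IHq by exact Hx; reflexivity.
  - split.
    + intros H v Hv Hp.
      (* Appending [v] to the history sends [x] exactly to [v]. *)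
      pose proof (position_move _ _ _ Hx Hv) as E.
      pose proof (live_mono _ _ (extends_cons _ h v) _ Hx) as Hx'.
      rewrite <- E; apply IHq, H; [exact Hx' | apply extends_cons |].
      apply IHp; [exact Hx' | now rewrite E].
    + intros H h' Hh Hp.
      pose proof (live_mono _ _ Hh _ Hx) as Hx'.
      apply IHq, H; [exact Hx' | now apply position_mono | now apply IHp].
  - split.
    + intros [[[x' a] h0] [_ [[[Hx0 Hh0] [-> [Ha Hd]]] H]]].
      exists a; split.
      * split; [exact Ha |].
        exact (nbhd_dom_upset M Ha _ (position_mono _ _ _ Hx0 Hh0) Hd).
      * intros w' Hw v Hv.
        pose proof (position_move _ _ _ Hx Hw) as E.
        (* The world [v] is represented by a state born in it at [w' :: h]. There [x] stands at
           [w'], so [Hv] makes this state a member of the given copy. *)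
        rewrite <- (position_birth (w' :: h) v).
        assert (Hy : live (w' :: h) (w' :: h, v)) by apply extends_refl.
        assert (Hh' : extends h0 (w' :: h))
          by exact (extends_trans _ _ _ _ Hh0 (extends_cons _ h w')).
        apply IHp, H; [exact Hy | apply extends_cons | exact Hy |].
        split; [now split | split; [exact Hy | split; [exact Hh' |]]].
        unfold fst, snd; now rewrite E.
    + intros [a [Ha H]]; exists (x, a, h).
      assert (Hn : copy_live h (x, a, h)) by (split; [exact Hx | apply extends_refl]).
      split; [exact Hn | split; [now split |]].
      intros h' Hh [h1 v] Hy [_ [_ [Hh1 Hv]]]; apply IHp; [exact Hy |].
      (* The member satisfied [p] at birth, in [v], and has only moved upwards since. *)
      apply (forces_mono M p v).
      * rewrite <- (position_birth h1 v) at 1.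
        apply position_mono; [apply extends_refl | exact Hy].
      * exact (H _ (position_mono _ _ _ Hx Hh1) v Hv).
  - split.
    + intros H w' Hw a Ha.
      pose proof (position_move _ _ _ Hx Hw) as E.
      assert (Hn : copy_live (w' :: h) (x, a, w' :: h)).
      { split; [exact (live_mono _ _ (extends_cons _ h w') _ Hx) | apply extends_refl]. }
      destruct (H _ (extends_cons _ h w') (x, a, w' :: h) Hn)
        as [[h1 v] [Hy [[_ [_ [Hh1 Hv]]] Hp]]].
      { split; [exact Hn | split; [reflexivity | now rewrite E]]. }
      (* The copy is new, so its members are born now. *)
      assert (Eh : h1 = w' :: h) by exact (extends_antisym _ _ _ Hy Hh1).
      subst h1; unfold fst, snd in Hv; rewrite E in Hv.
      exists v; split; [exact Hv |].
      rewrite <- (position_birth (w' :: h) v); now apply IHp.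
    + intros H h' Hh [[x' a] h0] Hn [_ [-> [Ha Hd]]].
      pose proof Hn as [Hx0 Hh0].
      destruct (H _ (position_mono _ _ _ Hx Hh) a) as [v [Hv Hp]].
      { split; [exact Ha |].
        exact (nbhd_dom_upset M Ha _ (position_mono _ _ _ Hx0 Hh0) Hd). }
      (* Even an old copy acquires a state born now in [v], which witnesses the diamond. *)
      assert (Hy : live h' (h', v)) by apply extends_refl.
      exists (h', v); split; [exact Hy | split].
      * split; [exact Hn | split; [exact Hy | now split]].
      * apply IHp; [exact Hy | now rewrite position_birth].
Qed.

End HistoryStructure.

Theorem theorem3p34 (Gamma : Ensemble form) (phi : form) :
  inm_consequence Gamma phi <-> ifom_consequence Gamma phi.
Proof.
  split.
  - intros H M w x _ HG.
    apply forces_pair_model, H; intros psi Hpsi.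
    now apply forces_pair_model, HG.
  - intros H M w HG.
    (* At the empty history the state [(nil, w)] stands in [w]. *)
    assert (Hx : live M nil (nil, w)) by apply extends_refl.
    apply (satisfies_hist_structure M phi nil (nil, w) Hx), H; [exact Hx |].
    intros psi Hpsi; apply (satisfies_hist_structure M psi nil (nil, w) Hx).
    now apply HG.
Qed.
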